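(* Let $p>1$, let $[X,\mathcal B,m^i,\nu_i]$ ($i=1,2$) be reversible random walk spaces on the same measurable space with $\nu_2\ll\nu_1$, $\mu=\frac{d\nu_2}{d\nu_1}\in L^\infty(X,\nu_1)$, $\mu\ge c>0$ $\nu_1$-a.e., and $\nu_1(X)<\infty$. Assume $\mathcal F_{1,m^1}$ satisfies a $2$-Poincaré inequality with constant $\lambda_2(\mathcal F_{1,m^1})>0$. For $u_0\in L^2(X,\nu_1)$ let $u$ be the strong solution of $u_t-\Delta_1^{m^1}u-\mu\Delta_p^{m^2}u\ni0$, $u(0)=u_0$. Then $$\|u(t)-\overline{u_0}\|_{L^2(X,\nu_1)}\le\big(\|u_0-\overline{u_0}\|_{L^2(X,\nu_1)}-\lambda_2(\mathcal F_{1,m^1})\,t\big)^+\qquad\forall t>0.$$ In particular, $T_{\rm ex}(u_0):=\inf\{T>0: u(t)=\overline{u_0}\ \forall t\ge T\}$ satisfies $T_{\rm ex}(u_0)\le\|u_0-\overline{u_0}\|_{L^2(X,\nu_1)}/\lambda_2(\mathcal F_{1,m^1})$.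
   Context: Random walk space $[X,\mathcal B,m,\nu]$: measurable space with countably generated $\sigma$-algebra, probability measures $m_x$ depending measurably on $x$, $\sigma$-finite invariant measure $\nu$ ($\nu(A)=\int m_x(A)\,d\nu(x)$), reversible if $dm_x(y)d\nu(x)=dm_y(x)d\nu(y)$. $\nabla u(x,y)=u(y)-u(x)$. $\mathcal F_{1,m^1}(u)=\frac12\int_{X\times X}|\nabla u|\,dm^1_x(y)d\nu_1(x)$ ($+\infty$ if infinite). $\overline{u}=\frac1{\nu_1(X)}\int_X u\,d\nu_1$. $\mathcal F_{1,m^1}$ satisfies an $r$-Poincaré inequality ($1\le r<\infty$) if there is $\lambda_r(\mathcal F_{1,m^1})>0$ with $\lambda_r\|u-\overline u\|_{L^r(X,\nu_1)}\le\mathcal F_{1,m^1}(u)$ for all $u\in L^r(X,\nu_1)$. $(u,v)\in\Delta_1^{m}$ iff $(u,-v)\in\partial_{L^2(X,\nu)}\mathcal F_{1,m}(u)$ (convex subdifferential). For $p>1$, $(u,w)\in\Delta_p^{m}$ iff $u,w\in L^2(X,\nu)$, $\nabla u\in L^p(dm_x(y)d\nu(x))$ and $w(x)=\int_X|\nabla u(x,y)|^{p-2}\nabla u(x,y)\,dm_x(y)$. The operator $A=-\Delta_1^{m^1}-\mu\Delta_p^{m^2}$ on $H=L^2(X,\nu_1)$: $(u,v)\in A$ iff $u,v\in H$, $v=v_1-\mu w$ with $(u,-v_1)\in\Delta_1^{m^1}$ (w.r.t. $\nu_1$) and $(u,w)\in\Delta_p^{m^2}$ (w.r.t. $\nu_2$).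 Strong solution: $u\in C([0,\infty);H)\cap W^{1,2}_{\rm loc}(0,\infty;H)$, $u(0)=u_0$, $-u_t(t)\in A(u(t))$ for a.e. $t$. *)

(* Defs.v *)
From HB Require Import structures.
From mathcomp Require Import all_boot all_order all_algebra.
From mathcomp Require Import all_classical all_reals all_analysis.
Set Implicit Arguments.
Unset Strict Implicit.
Unset Printing Implicit Defensive.
Import Order.TTheory GRing.Theory Num.Theory.
Import numFieldNormedType.Exports.
Local Open Scope classical_set_scope.
Local Open Scope ring_scope.

Section RWS.
Context {d : measure_display} {T : measurableType d} {R : realType}.

Definition countably_generated : Prop :=
  exists G : nat -> set T, @measurable d T = <<s range G>>.

Definition invariant_measure (m : R.-pker T ~> T)
    (nu : {measure set T -> \bar R}) : Prop :=
  forall A, measurable A -> nu A = (\int[nu]_x m x A)%E.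

Definition random_walk_space (m : R.-pker T ~> T)
    (nu : {measure set T -> \bar R}) : Prop :=
  [/\ countably_generated, sigma_finite setT nu & invariant_measure m nu].

(* reversibility: dm_x(y) dnu(x) = dm_y(x) dnu(y) as measures on X x X,
   stated on measurable rectangles A x B *)
Definition reversible (m : R.-pker T ~> T)
    (nu : {measure set T -> \bar R}) : Prop :=
  forall A B, measurable A -> measurable B ->
    (\int[nu]_(x in A) m x B = \int[nu]_(x in B) m x A)%E.

Definition L2 (nu : {measure set T -> \bar R}) (u : T -> R) : Prop :=
  measurable_fun setT u /\ (\int[nu]_x ((u x) ^+ 2)%:E < +oo)%E.

Definition L2norm (nu : {measure set T -> \bar R}) (u : T -> R) : \bar R :=
  Lnorm nu 2%:E (fun x => (u x)%:E).

Definition L2inner (nu : {measure set T -> \bar R}) (u v : T -> R) : \bar R :=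
  (\int[nu]_x (u x * v x)%:E)%E.

Definition mean (nu : {measure set T -> \bar R}) (u : T -> R) : R :=
  (fine (nu setT))^-1 * fine (\int[nu]_x (u x)%:E)%E.

Definition F1 (m : R.-pker T ~> T) (nu : {measure set T -> \bar R})
    (u : T -> R) : \bar R :=
  ((2^-1)%:E * \int[nu]_x \int[m x]_y (`|u y - u x|)%:E)%E.

Definition poincare (r : R) (m : R.-pker T ~> T)
    (nu : {measure set T -> \bar R}) (lam : R) : Prop :=
  0 < lam /\
  forall u : T -> R, measurable_fun setT u ->
    (\int[nu]_x (`|u x| `^ r)%:E < +oo)%E ->
    (lam%:E * Lnorm nu r%:E (fun x => (u x - mean nu u)%:E) <= F1 m nu u)%E.

Definition subdiff (F : (T -> R) -> \bar R) (nu : {measure set T -> \bar R})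
    (u h : T -> R) : Prop :=
  [/\ L2 nu u, L2 nu h &
      forall w, L2 nu w ->
        (F u + L2inner nu h (fun x => (w x - u x)%R) <= F w)%E].

Definition Delta1 (m : R.-pker T ~> T) (nu : {measure set T -> \bar R})
    (u v : T -> R) : Prop :=
  subdiff (F1 m nu) nu u (fun x => - v x).

(* |a|^{p-2} a  (with value 0 at a = 0) *)
Definition phip (p a : R) : R := Num.sg a * (`|a| `^ (p - 1)).

Definition Deltap (p : R) (m : R.-pker T ~> T) (nu : {measure set T -> \bar R})
    (u w : T -> R) : Prop :=
  [/\ L2 nu u, L2 nu w,
      (\int[nu]_x \int[m x]_y (`|u y - u x| `^ p)%:E < +oo)%E &
      {ae nu, forall x, (w x)%:E = (\int[m x]_y (phip p (u y - u x))%:E)%E}].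

Definition opA (p : R) (m1 m2 : R.-pker T ~> T)
    (nu1 nu2 : {measure set T -> \bar R}) (mu : T -> R) (u v : T -> R) : Prop :=
  [/\ L2 nu1 u, L2 nu1 v &
      exists v1 w, [/\ {ae nu1, forall x, v x = v1 x - mu x * w x},
                       Delta1 m1 nu1 u (fun x => - v1 x) &
                       Deltap p m2 nu2 u w]].

(* u \in W^{1,2}_loc(0,oo; L^2(X,nu)) with (a.e.) time derivative g:
   g is locally square integrable in time with values in L^2 and
   u(t) - u(s) = \int_s^t g(r) dr (tested against every phi in L^2). *)
Definition W12loc_deriv (nu : {measure set T -> \bar R})
    (u g : R -> T -> R) : Prop :=
  [/\ {ae lebesgue_measure, forall t, 0 < t -> L2 nu (g t)},
      measurable_fun (`]0%R, +oo[ : set R) (fun t : R => fine (L2norm nu (g t))),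
      (forall a b, 0 < a -> a < b ->
         (\int[lebesgue_measure]_(t in `[a, b]) (fine (L2norm nu (g t)) ^+ 2)%:E
            < +oo)%E) &
      forall phi, L2 nu phi -> forall s t, 0 < s -> s < t ->
        lebesgue_measure.-integrable `[s, t]
          (fun r => L2inner nu (g r) phi) /\
        L2inner nu (fun x => (u t x - u s x)%R) phi =
          (\int[lebesgue_measure]_(r in `[s, t]) L2inner nu (g r) phi)%E].

Definition strong_solution (p : R) (m1 m2 : R.-pker T ~> T)
    (nu1 nu2 : {measure set T -> \bar R}) (mu : T -> R)
    (u0 : T -> R) (u : R -> T -> R) : Prop :=
  [/\
      (forall t, 0 <= t -> L2 nu1 (u t)),
      (forall t, 0 <= t -> forall e : R, 0 < e -> exists2 delta : R, 0 < delta &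
         forall s, 0 <= s -> `|s - t| < delta ->
           (L2norm nu1 (fun x => (u s x - u t x)%R) < e%:E)%E),
      {ae nu1, forall x, u 0 x = u0 x} &
      exists g, W12loc_deriv nu1 u g /\
        {ae lebesgue_measure, forall t, 0 < t ->
           opA p m1 m2 nu1 nu2 mu (u t) (fun x => - g t x)}].

Definition extinction_time (nu : {measure set T -> \bar R}) (u : R -> T -> R)
    (c : R) : \bar R :=
  ereal_inf [set T0%:E | T0 in [set T0 : R | 0 < T0 /\
     forall t, (T0 <= t)%R -> {ae nu, forall x, u t x = c}]].

End RWS.

(* Main.v *)
Require Import Defs.
From HB Require Import structures.
From mathcomp Require Import all_boot all_order all_algebra.
From mathcomp Require Import all_classical all_reals all_analysis.
From mathcomp Require Import measurable_realfun lra ring.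
Import Order.TTheory GRing.Theory Num.Theory.
Import numFieldNormedType.Exports.
Local Open Scope classical_set_scope.
Local Open Scope ring_scope.

Set Implicit Arguments.
Unset Strict Implicit.
Unset Printing Implicit Defensive.

(** Let [N t] be the L^2 distance from [u t] to the mean of [u0].  Testing the
    subdifferential inequality for [F1] with [0] and with translates of [u t],
    and antisymmetrising the integral that defines the p-Laplacian, shows that
    the velocity [g t] has mean zero and, by the Poincare inequality,
    <g t, u t> <= - F1 (u t) <= - lam * N t.  Hence the mean is conserved and
    (N^2)' <= - 2 lam N, i.e. N' <= - lam as long as N > 0.
    When p > 2 the function |grad u|^(p-1) |u| need not be integrable, so the
    p-Laplacian is first tested against truncations of [u]. *)

(** * Positive functionals *)

Section daniell.
Local Open Scope ereal_scope.
Context (d : measure_display) (T : measurableType d) (R : realType).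
Implicit Types (I J : (T -> \bar R) -> \bar R) (f g : T -> \bar R).

(** The measure dm_x(y) dnu(x) on pairs appears only through iterated integrals, and reversibility
    is given only on rectangles. The antisymmetrisation therefore rests on a uniqueness principle
    for positive functionals, which also yields the change of measure from [nu2] to [nu1]. In time,
    [g] is known only through the integrals of <g, phi> with phi fixed, so N^2 is never
    differentiated. Its inequality is proved on short intervals up to e times the increment of the
    integral of ||g||; this error is additive, so the intervals can be glued and e sent to 0. The
    rate on an interval uses a lower bound of N there: the bound 0 first gives monotonicity, and
    monotonicity then makes the value of N at the right end an admissible lower bound. The equation
    holds at positive times only, so time 0 is always reached by continuity. *)

Definition nonneg_measurable (f : T -> \bar R) : Prop :=
  measurable_fun setT f /\ forall x, 0 <= f x.

(** Additivity, positive homogeneity and monotone convergence are all that the uniqueness argument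
    uses. Plain, weighted, iterated and swapped integrals are all instances. *)
Definition daniell I : Prop :=
  [/\ forall f g, nonneg_measurable f -> nonneg_measurable g ->
        I (fun x => f x + g x) = I f + I g,
      forall (c : R) f, (0 <= c)%R -> nonneg_measurable f ->
        I (fun x => c%:E * f x) = c%:E * I f &
      forall h : nat -> T -> \bar R, (forall n, nonneg_measurable (h n)) ->
        (forall x, nondecreasing_seq (h ^~ x)) ->
        I (fun x => limn (h ^~ x)) = limn (fun n => I (h n))].

Lemma nonneg_measurable_indic (A : set T) (c : R) : (0 <= c)%R -> measurable A ->
  nonneg_measurable (fun x => c%:E * (\1_A x)%:E).
Proof.
move=> c0 mA; split; last by move=> x; rewrite mule_ge0// lee_fin.
by apply: measurable_funeM; exact/measurable_EFinP.
Qed.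

Lemma nonneg_measurable0 : nonneg_measurable (cst 0).
Proof. by split. Qed.

Lemma nonneg_measurable_sum (K : Type) (s : seq K) (h : K -> T -> \bar R) :
  (forall k, nonneg_measurable (h k)) ->
  nonneg_measurable (fun x => \sum_(k <- s) h k x).
Proof.
move=> hh; split.
  by apply: emeasurable_sum => // k; case: (hh k).
by move=> x; apply: sume_ge0 => k _; case: (hh k).
Qed.

Lemma daniell0 I : daniell I -> I (cst 0) = 0.
Proof.
case=> _ IZ _; have := IZ 0%R (cst 0) (lexx _) nonneg_measurable0.
rewrite mul0e => E; rewrite -[RHS]E; congr I; apply/funext => x.
by rewrite mul0e.
Qed.

Lemma daniell_sum I (K : Type) (s : seq K) (h : K -> T -> \bar R) :
  daniell I -> (forall k, nonneg_measurable (h k)) ->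
  I (fun x => \sum_(k <- s) h k x) = \sum_(k <- s) I (h k).
Proof.
move=> dI hh; elim: s => [|k s IH].
  rewrite big_nil -[RHS](daniell0 dI); congr I; apply/funext => x.
  by rewrite big_nil.
rewrite big_cons -IH; case: (dI) => ID _ _; rewrite -ID//; last first.
  exact: nonneg_measurable_sum.
by congr I; apply/funext => x; rewrite big_cons.
Qed.

Import HBNNSimple.

(** A nonnegative measurable function is an increasing limit of simple functions, and these are
    finite nonnegative combinations of indicators. *)
Lemma daniell_ext I J : daniell I -> daniell J ->
  (forall A, measurable A -> I (EFin \o \1_A) = J (EFin \o \1_A)) ->
  forall f, nonneg_measurable f -> I f = J f.
Proof.
move=> dI dJ IJ f [mf f0].
pose h := nnsfun_approx measurableT mf.
have hh n : nonneg_measurable (EFin \o h n).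
  by split => [|x /=]; [exact/measurable_EFinP|rewrite lee_fin].
have ndh x : nondecreasing_seq (fun n => (h n x)%:E).
  by move=> a b ab; rewrite lee_fin; exact/lefP/nd_nnsfun_approx.
have fE : f = fun x => limn (fun n => (h n x)%:E).
  apply/funext => x; apply/esym/cvg_lim => //; exact: cvg_nnsfun_approx.
case: (dI) => _ IZ Il; case: (dJ) => _ JZ Jl.
rewrite fE (Il (fun n => EFin \o h n) hh ndh) (Jl (fun n => EFin \o h n) hh ndh).
congr (limn _); apply/funext => n.
pose s : seq R := finmap.enum_fset (fset_set (range (h n))).
(* The maximum with 0 changes no value in the range of [h n]; it makes the coefficient nonnegative
   for every real y, as [daniell_sum] asks of all indices. *)
have hE : EFin \o h n = fun x => \sum_(y <- s)
    ((Num.max y 0%R)%:E * (\1_(h n @^-1` [set y]) x)%:E).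
  apply/funext => x /=; rewrite [in LHS](fimfunE (h n)) fsbig_finite//= -sumEFin.
  apply: eq_big_seq => y ys.
  have : y \in range (h n) by move: ys; rewrite in_fset_set//.
  by rewrite inE => -[z _ <-]; rewrite EFinM (max_idPl _).
have hm y : nonneg_measurable
    (fun x => (Num.max y 0%R)%:E * (\1_(h n @^-1` [set y]) x)%:E).
  by apply: nonneg_measurable_indic => //; rewrite le_max lexx orbT.
rewrite hE !daniell_sum//; apply: eq_bigr => y _.
have m0 : (0 <= Num.max y 0)%R by rewrite le_max lexx orbT.
have h1 : nonneg_measurable (EFin \o \1_(h n @^-1` [set y])).
  by split => [|x /=]; [exact/measurable_EFinP|rewrite lee_fin].
by have := IZ _ _ m0 h1; have := JZ _ _ m0 h1 => /= -> ->; rewrite IJ.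
Qed.

(** The sets on whose indicators I and J agree form a lambda-system. Finiteness of I on indicators
    is what allows cancellation for a proper difference. *)
Lemma daniell_pi_lambda I J (G : set (set T)) : daniell I -> daniell J ->
  measurable = <<s G >> -> setI_closed G ->
  (forall A, G A -> I (EFin \o \1_A) = J (EFin \o \1_A)) ->
  I (EFin \o \1_setT) = J (EFin \o \1_setT) ->
  (forall A, measurable A -> I (EFin \o \1_A) \is a fin_num) ->
  forall A, measurable A -> I (EFin \o \1_A) = J (EFin \o \1_A).
Proof.
move=> dI dJ mG GI IJG IJT Ifin A mA.
have h1 B : measurable B -> nonneg_measurable (EFin \o \1_B : T -> \bar R).
  by move=> mB; split => [|x /=]; [exact/measurable_EFinP|rewrite lee_fin].
pose H := [set B | measurable B /\ I (EFin \o \1_B) = J (EFin \o \1_B)].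
suff : <<s G >> `<=` H by move=> /(_ A); rewrite -mG => /(_ mA)[].
apply: lambda_system_subset => //; last first.
  move=> B GB; split; last exact: IJG.
  by rewrite mG; exact: sub_sigma_algebra.
split => //.
- move=> C B BC [mC IC] [mB IB]; split; first exact: measurableD.
  have E (K : (T -> \bar R) -> \bar R) : daniell K -> K (EFin \o \1_C) =
      K (EFin \o \1_(C `\` B)) + K (EFin \o \1_B).
    case=> KD _ _; rewrite -KD; [|exact/h1/measurableD|exact: h1].
    congr K; apply/funext => x /=; rewrite -EFinD; congr EFin.
    rewrite !indicE in_setD; have [xB|xB] := boolP (x \in B) => /=.
      by rewrite andbF add0r mem_set//; apply: BC; rewrite inE in xB.
    by rewrite andbT addr0.
  have := IC; rewrite (E I)// (E J)// -IB.
  by move/(congr1 (fun z => z - I (EFin \o \1_B))); rewrite !addeK ?Ifin.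
- move=> F ndF HF.
  have mF n : measurable (F n) by have [] := HF n.
  split; first exact: bigcupT_measurable.
  have E (K : (T -> \bar R) -> \bar R) : daniell K -> K (EFin \o \1_(\bigcup_n F n)) =
      limn (fun n => K (EFin \o \1_(F n))).
    case=> _ _ Kl; rewrite -Kl.
    - congr K; apply/funext => x /=; apply/esym/cvg_lim => //.
      have [[N _ FNx]|nF] := pselect ((\bigcup_n F n) x).
        apply: cvg_near_cst; exists N => // n /= Nn.
        have Fnx : F n x by move/subsetPset : (ndF _ _ Nn); exact.
        by rewrite !indicE !mem_set//; exists N.
      apply: cvg_near_cst; apply: nearW => n.
      by rewrite !indicE !memNset// => Fx; apply: nF; exists n.
    - by move=> n; exact: h1.
    - move=> x a b ab /=; rewrite lee_fin !indicE ler_nat.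
      case: (boolP (x \in F a)) => //; rewrite inE => Fx.
      by rewrite mem_set//; move/subsetPset : (ndF _ _ ab); exact.
  rewrite !E//; congr (limn _); apply/funext => n; by have [] := HF n.
Qed.

End daniell.

(** * Integrals against measures, densities and kernels; reversibility *)

Section daniell_instances.
Local Open Scope ereal_scope.
Context (d : measure_display) (T : measurableType d) (R : realType).

Lemma nonneg_measurable_comp (d1 d2 : measure_display)
    (T1 : measurableType d1) (T2 : measurableType d2)
    (phi : T1 -> T2) (f : T2 -> \bar R) :
  measurable_fun setT phi -> nonneg_measurable f -> nonneg_measurable (f \o phi).
Proof. by move=> mphi [mf f0]; split=> [|x /=]; [exact: measurableT_comp|]. Qed.

Lemma daniell_integral (nu : {measure set T -> \bar R}) :
  daniell (fun f => \int[nu]_x f x).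
Proof.
split.
- by move=> f g [mf f0] [mg g0]; rewrite ge0_integralD.
- by move=> c f c0 [mf f0]; rewrite ge0_integralZl.
- move=> h hh ndh; apply: monotone_convergence => //.
  + by move=> n; case: (hh n).
  + by move=> n x _; case: (hh n).
Qed.

Lemma daniell_density (nu : {measure set T -> \bar R}) (rho : T -> R) :
  measurable_fun setT rho -> (forall x, (0 <= rho x)%R) ->
  daniell (fun f => \int[nu]_x (f x * (rho x)%:E)).
Proof.
move=> mrho rho0.
have mrhoE : measurable_fun setT (EFin \o rho) by exact/measurable_EFinP.
have hM (f : T -> \bar R) : nonneg_measurable f -> nonneg_measurable (fun x => f x * (rho x)%:E).
  case=> mf f0; split; first exact: emeasurable_funM.
  by move=> x; rewrite mule_ge0// lee_fin.
have [ID IZ Il] := daniell_integral nu; split.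
- move=> f g hf hg; rewrite -ID; [|exact: hM|exact: hM].
  by apply: eq_integral => x _; rewrite ge0_muleDl//; [case: hf|case: hg].
- move=> c f c0 hf; rewrite -IZ; [|by []|exact: hM].
  by apply: eq_integral => x _; rewrite muleA.
- move=> h hh ndh; rewrite -(Il (fun n x => h n x * (rho x)%:E)).
  + apply: eq_integral => x _; apply/esym/cvg_lim => //; apply: cvgeZr => //.
    exact: ereal_nondecreasing_is_cvgn.
  + by move=> n; exact: hM.
  + by move=> x a b ab; rewrite lee_wpmul2r ?lee_fin// ndh.
Qed.

Lemma daniell_comp (d1 d2 : measure_display)
    (T1 : measurableType d1) (T2 : measurableType d2)
    (phi : T1 -> T2) (I : (T1 -> \bar R) -> \bar R) :
  measurable_fun setT phi -> daniell I -> daniell (fun f => I (f \o phi)).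
Proof.
move=> mphi [ID IZ Il].
have hC (f : T2 -> \bar R) : nonneg_measurable f -> nonneg_measurable (f \o phi).
  exact: nonneg_measurable_comp.
split.
- by move=> f g hf hg; apply: (ID (f \o phi) (g \o phi)); exact: hC.
- by move=> c f c0 hf; apply: (IZ c (f \o phi)) => //; exact: hC.
- move=> h hh ndh; apply: (Il (fun n => h n \o phi)) => [n|x].
  + exact: hC.
  + exact: ndh.
Qed.

Lemma nonneg_measurable_kernel (m : R.-pker T ~> T) (f : T * T -> \bar R) :
  nonneg_measurable f -> nonneg_measurable (fun x => \int[m x]_y f (x, y)).
Proof.
case=> mf f0; split; last by move=> x; exact: integral_ge0.
exact: (measurable_fun_integral_finite_kernel f m).
Qed.

Lemma nonneg_measurable_section (f : T * T -> \bar R) x :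
  nonneg_measurable f -> nonneg_measurable (fun y => f (x, y)).
Proof.
move=> hf; apply: (@nonneg_measurable_comp _ _ T (T * T)%type (pair x) f) => //.
Qed.

(** This functional stands in for integration against dm_x(y) dnu(x); each property is obtained for
    the inner integral and then for the outer one. *)
Lemma daniell_kernel (m : R.-pker T ~> T) (nu : {measure set T -> \bar R}) :
  daniell (fun f : T * T -> \bar R => \int[nu]_x \int[m x]_y f (x, y)).
Proof.
have [ID IZ Il] := daniell_integral nu.
split.
- move=> f g hf hg; rewrite -ID; [|exact: nonneg_measurable_kernel..].
  apply: eq_integral => x _; have [KD _ _] := daniell_integral (m x).
  by rewrite KD//; exact: nonneg_measurable_section.
- move=> c f c0 hf; rewrite -IZ; [|by []|exact: nonneg_measurable_kernel].
  apply: eq_integral => x _; have [_ KZ _] := daniell_integral (m x).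
  by rewrite KZ//; exact: nonneg_measurable_section.
- move=> h hh ndh; rewrite -(Il (fun n x => \int[m x]_y h n (x, y))).
  + apply: eq_integral => x _; have [_ _ Kl] := daniell_integral (m x).
    rewrite (Kl (fun n y => h n (x, y)))//.
    by move=> n; exact: nonneg_measurable_section.
  + by move=> n; exact: nonneg_measurable_kernel.
  + move=> x a b ab; apply: ge0_le_integral => //.
    * by move=> y _; case: (hh a).
    * by case: (nonneg_measurable_section x (hh a)).
    * by case: (nonneg_measurable_section x (hh b)).
    * by move=> y _; exact: ndh.
Qed.

Lemma integral_density (nu1 nu2 : {measure set T -> \bar R}) (rho : T -> R) :
  measurable_fun setT rho -> (forall x, (0 <= rho x)%R) ->
  (forall A, measurable A -> nu2 A = \int[nu1]_(x in A) (rho x)%:E) ->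
  forall f, nonneg_measurable f ->
  \int[nu2]_x f x = \int[nu1]_x (f x * (rho x)%:E).
Proof.
move=> mrho rho0 nu2E.
apply: daniell_ext; [exact: daniell_integral|exact: daniell_density|].
move=> A mA /=; rewrite integral_indic// setIT nu2E// integral_mkcond.
by apply: eq_integral => x _; rewrite epatch_indic muleC.
Qed.

(* [reversible] speaks of rectangles only; these form a pi-system. *)
Lemma reversible_swap (m : R.-pker T ~> T) (nu : {measure set T -> \bar R}) :
  reversible m nu -> nu setT < +oo ->
  forall f : T * T -> \bar R, nonneg_measurable f ->
  \int[nu]_x \int[m x]_y f (x, y) = \int[nu]_x \int[m x]_y f (y, x).
Proof.
move=> rev nufin.
have mswap : measurable_fun setT (fun z : T * T => (z.2, z.1)).
  exact/measurable_fun_pair.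
have dI := daniell_kernel m nu.
have dJ : daniell (fun f : T * T -> \bar R => \int[nu]_x \int[m x]_y f (y, x)).
  exact: (daniell_comp mswap dI).
have rectE A B : measurable A -> measurable B ->
    \int[nu]_x \int[m x]_y (EFin \o \1_(A `*` B)) (x, y) =
    \int[nu]_(x in A) m x B.
  move=> mA mB; rewrite [RHS]integral_mkcond; apply: eq_integral => x _.
  rewrite epatch_indic /=.
  transitivity (\int[m x]_y ((\1_A x : R)%:E * (\1_B y)%:E)).
    by apply: eq_integral => y _; rewrite !indicE in_setX -mulnb natrM EFinM.
  rewrite ge0_integralZl ?lee_fin//; last exact/measurable_EFinP.
  by rewrite integral_indic// setIT muleC.
apply: (daniell_ext dI dJ).
apply: (daniell_pi_lambda dI dJ (measurable_prod_measurableType _ _)).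
- move=> _ _ [A mA [B mB <-]] [C mC [D mD <-]].
  exists (A `&` C); first exact: measurableI.
  exists (B `&` D); first exact: measurableI.
  by rewrite setXI.
- move=> _ [A mA [B mB <-]].
  transitivity (\int[nu]_(x in A) m x B); first exact: rectE.
  rewrite rev//; transitivity (\int[nu]_x \int[m x]_y
    (EFin \o \1_(B `*` A)) (x, y)); first by apply/esym/rectE.
  apply: eq_integral => x _; apply: eq_integral => y _ /=.
  by rewrite !indicE !in_setX andbC.
- by apply: eq_integral => x _; apply: eq_integral => y _ /=; rewrite !indicT.
(* Each [m x] is a probability, so the iterated integral of an indicator is at most [nu setT]; this
   is where finiteness of nu enters. *)
- move=> A mA; rewrite ge0_fin_numE; last first.
    by apply: integral_ge0 => x _; apply: integral_ge0 => y _; rewrite lee_fin.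
  have h1 : nonneg_measurable (EFin \o \1_A : T * T -> \bar R).
    by split => [|x /=]; [exact/measurable_EFinP|rewrite lee_fin].
  apply: le_lt_trans nufin; rewrite -[leRHS]mul1e -integral_cst//.
  apply: ge0_le_integral => //.
  + by move=> x _; apply: integral_ge0 => y _; rewrite lee_fin.
  + by case: (nonneg_measurable_kernel m h1).
  + move=> x _; rewrite -(@prob_kernel _ _ _ _ _ m x) -[leRHS]mul1e -integral_cst//.
    apply: ge0_le_integral => //.
    * by move=> y _; rewrite lee_fin.
    * by case: (nonneg_measurable_section x h1).
    * by move=> y _; rewrite /= lee_fin indicE; case: (_ \in _).
Qed.

End daniell_instances.

(** * L2 inner product and norm *)

Section L2_theory.
Context (d : measure_display) (T : measurableType d) (R : realType).
Variable nu : {measure set T -> \bar R}.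
Implicit Types (f g h : T -> R) (a : R).

(** Real-valued through [fine], so that estimates take place in R; it represents [L2inner]
    faithfully on L2, by [L2innerE]. *)
Definition ip f g : R := \int[nu]_x (f x * g x).

Definition nrm f : R := fine (L2norm nu f).

Lemma L2_measurable f : L2 nu f -> measurable_fun setT f.
Proof. by case. Qed.

Lemma L2_integrable_sqr f : L2 nu f ->
  nu.-integrable setT (fun x => (f x ^+ 2)%:E).
Proof.
case=> mf fi; apply/integrableP; split.
  exact/measurable_EFinP/measurable_funX.
by under eq_integral => x _ do rewrite gee0_abs ?lee_fin ?sqr_ge0//.
Qed.

(** The bound has the form that (g + h)^2 satisfies; with g = h it also covers truncations. *)
Lemma L2_le f g h : measurable_fun setT f -> L2 nu g -> L2 nu h ->
  (forall x, f x ^+ 2 <= 2 * g x ^+ 2 + 2 * h x ^+ 2) -> L2 nu f.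
Proof.
move=> mf Lg Lh fgh; split => //.
have : nu.-integrable setT (fun x => (2 * g x ^+ 2 + 2 * h x ^+ 2)%:E).
  under eq_fun => x do rewrite EFinD !EFinM.
  by apply: integrableD => //; apply: integrableZl => //; exact: L2_integrable_sqr.
case/integrableP => mgh; apply: le_lt_trans; apply: ge0_le_integral => //.
- by move=> x _; rewrite lee_fin sqr_ge0.
- exact/measurable_EFinP/measurable_funX.
- exact: measurableT_comp.
- by move=> x _; rewrite lee_fin (le_trans (fgh x))// ler_norm.
Qed.

Lemma L2D f g : L2 nu f -> L2 nu g -> L2 nu (fun x => f x + g x).
Proof.
move=> Lf Lg; apply: (L2_le _ Lf Lg).
  by apply: measurable_funD; exact: L2_measurable.
move=> x; have := sqr_ge0 (f x - g x); nra.
Qed.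

Lemma L2Z a f : L2 nu f -> L2 nu (fun x => a * f x).
Proof.
move=> Lf; split; first by apply: measurable_funM => //; exact: L2_measurable.
have /integrableP[_] := integrableZl measurableT (a ^+ 2) (L2_integrable_sqr Lf).
apply: le_lt_trans; apply: ge0_le_integral => //.
- by move=> x _; rewrite lee_fin sqr_ge0.
- apply/measurable_EFinP/measurable_funX/measurable_funM => //.
  exact: L2_measurable.
- apply: measurableT_comp => //; apply: measurable_funeM.
  exact/measurable_EFinP/measurable_funX/L2_measurable.
- by move=> x _; rewrite exprMn EFinM lee_abs.
Qed.

Lemma L2N f : L2 nu f -> L2 nu (fun x => - f x).
Proof. by move=> /(L2Z (-1)); under eq_fun => x do rewrite mulN1r. Qed.

Lemma L2B f g : L2 nu f -> L2 nu g -> L2 nu (fun x => f x - g x).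
Proof. by move=> Lf Lg; exact/L2D/L2N. Qed.

Lemma L2_cst a : (nu setT < +oo)%E -> L2 nu (fun=> a).
Proof.
move=> nufin; split => //.
by rewrite (integral_cst nu measurableT (a ^+ 2)%:E) lte_mul_pinfty// lee_fin sqr_ge0.
Qed.

Lemma integrable_mulL2 f g : L2 nu f -> L2 nu g ->
  nu.-integrable setT (EFin \o (fun x => f x * g x)).
Proof.
move=> Lf Lg; apply: (@le_integrable _ _ _ nu setT measurableT _
  (fun x => (f x ^+ 2)%:E + (g x ^+ 2)%:E)%E).
- by apply/measurable_EFinP/measurable_funM; exact: L2_measurable.
- move=> x _ /=; rewrite lee_fin; rewrite [leRHS]ger0_norm ?addr_ge0 ?sqr_ge0//.
  by rewrite ler_norml; apply/andP; split; nra.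
- by apply: integrableD => //; exact: L2_integrable_sqr.
Qed.

Lemma L2innerE f g : L2 nu f -> L2 nu g -> L2inner nu f g = (ip f g)%:E.
Proof.
move=> Lf Lg; rewrite /ip /Rintegral fineK//.
exact: integrable_fin_num (integrable_mulL2 Lf Lg).
Qed.

Lemma ipC f g : ip f g = ip g f.
Proof. by apply: eq_Rintegral => x _; rewrite mulrC. Qed.

Lemma ipDl f g h : L2 nu f -> L2 nu g -> L2 nu h ->
  ip (fun x => f x + g x) h = ip f h + ip g h.
Proof.
move=> Lf Lg Lh; rewrite -RintegralD//; [|exact: integrable_mulL2..].
by apply: eq_Rintegral => x _; rewrite mulrDl.
Qed.

Lemma ipZl a f g : L2 nu f -> L2 nu g -> ip (fun x => a * f x) g = a * ip f g.
Proof.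
move=> Lf Lg; rewrite -RintegralZl//; last exact: integrable_mulL2.
by apply: eq_Rintegral => x _; rewrite mulrA.
Qed.

Lemma ipNl f g : L2 nu f -> L2 nu g -> ip (fun x => - f x) g = - ip f g.
Proof.
move=> Lf Lg; rewrite -mulN1r -ipZl//; congr ip.
by apply/funext => x; rewrite mulN1r.
Qed.

Lemma ipBl f g h : L2 nu f -> L2 nu g -> L2 nu h ->
  ip (fun x => f x - g x) h = ip f h - ip g h.
Proof. by move=> Lf Lg Lh; rewrite ipDl// ?ipNl//; exact: L2N. Qed.

Lemma ipDr f g h : L2 nu f -> L2 nu g -> L2 nu h ->
  ip f (fun x => g x + h x) = ip f g + ip f h.
Proof. by move=> Lf Lg Lh; rewrite ipC ipDl// (ipC g) (ipC h). Qed.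

Lemma ipZr a f g : L2 nu f -> L2 nu g -> ip f (fun x => a * g x) = a * ip f g.
Proof. by move=> Lf Lg; rewrite ipC ipZl// ipC. Qed.

Lemma ip_ae_eql f f' g : L2 nu f -> L2 nu f' -> L2 nu g ->
  {ae nu, forall x, f x = f' x} -> ip f g = ip f' g.
Proof.
move=> Lf Lf' Lg ff'; rewrite /ip /Rintegral; congr fine.
apply: ae_eq_integral => //.
- by apply/measurable_EFinP/measurable_funM; exact: L2_measurable.
- by apply/measurable_EFinP/measurable_funM; exact: L2_measurable.
- by apply: filterS ff' => x -> _.
Qed.

Lemma ip_sqr_ge0 f : 0 <= ip f f.
Proof. by apply: Rintegral_ge0 => x _; rewrite -expr2 sqr_ge0. Qed.

Lemma L2normE f : L2 nu f -> L2norm nu f = (Num.sqrt (ip f f))%:E.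
Proof.
move=> Lf; rewrite /L2norm unlock.
under eq_integral => x _ do
  rewrite /= powR_mulrn ?normr_ge0// real_normK ?num_real// expr2.
by rewrite [X in (X `^ _)%E](L2innerE Lf Lf) poweR_EFin powR12_sqrt// ip_sqr_ge0.
Qed.

Lemma L2norm_nrm f : L2 nu f -> L2norm nu f = (nrm f)%:E.
Proof. by move=> Lf; rewrite /nrm L2normE. Qed.

Lemma nrm_sqr f : L2 nu f -> nrm f ^+ 2 = ip f f.
Proof. by move=> Lf; rewrite /nrm L2normE//= sqr_sqrtr// ip_sqr_ge0. Qed.

Lemma nrm_ge0 f : 0 <= nrm f.
Proof. by rewrite fine_ge0// Lnorm_ge0. Qed.

Lemma nrm_ae_eq f f' : L2 nu f -> L2 nu f' ->
  {ae nu, forall x, f x = f' x} -> nrm f = nrm f'.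
Proof.
move=> Lf Lf' ff'; rewrite /nrm !L2normE//= (ip_ae_eql Lf Lf' Lf ff') ipC.
by rewrite (ip_ae_eql Lf Lf' Lf' ff').
Qed.

Lemma ip_le_nrm f g : L2 nu f -> L2 nu g -> `|ip f g| <= nrm f * nrm g.
Proof.
move=> Lf Lg; rewrite -lee_fin EFinM -!L2norm_nrm//.
have := @hoelder _ _ _ nu f g 2 2 (L2_measurable Lf) (L2_measurable Lg).
move=> /(_ ltac:(by []) ltac:(by [])).
have -> : 2^-1 + 2^-1 = 1 :> R by lra.
move=> /(_ erefl); apply: le_trans; rewrite Lnorm1.
have := le_normr_Rintegral measurableT (integrable_mulL2 Lf Lg).
rewrite -lee_fin; move=> /le_trans; apply.
rewrite /Rintegral fineK//.
have := integrable_abse (integrable_mulL2 Lf Lg).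
by move=> /(integrable_fin_num measurableT).
Qed.

Lemma nrmD f g : L2 nu f -> L2 nu g -> nrm (fun x => f x + g x) <= nrm f + nrm g.
Proof.
move=> Lf Lg; rewrite -lee_fin EFinD -!L2norm_nrm//; last exact: L2D.
by apply: minkowski_EFin; [exact: L2_measurable..|rewrite ler1n].
Qed.

Lemma nrmN f : nrm (fun x => - f x) = nrm f.
Proof. by rewrite /nrm /L2norm -[in RHS]oppe_Lnorm. Qed.

Lemma nrm_distC f g : nrm (fun x => f x - g x) = nrm (fun x => g x - f x).
Proof. by rewrite -nrmN; congr nrm; apply/funext => x; rewrite opprB. Qed.

Lemma nrm_triangle f g h : L2 nu f -> L2 nu g -> L2 nu h ->
  nrm (fun x => f x - h x) <= nrm (fun x => f x - g x) + nrm (fun x => g x - h x).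
Proof.
move=> Lf Lg Lh; apply: le_trans (nrmD (L2B Lf Lg) (L2B Lg Lh)).
by rewrite le_eqVlt; apply/orP; left; apply/eqP; congr nrm; apply/funext => x; ring.
Qed.

End L2_theory.

(** * Dissipativity of the operator *)

Section phip.
Context (R : realType) (p : R).
Hypothesis p1 : 1 < p.
Implicit Types a : R.

Lemma phipN a : phip p (- a) = - phip p a.
Proof. by rewrite /phip sgrN normrN mulNr. Qed.

Lemma phip_ge0 a : 0 <= a -> 0 <= phip p a.
Proof. by move=> a0; rewrite mulr_ge0 ?sgr_ge0 ?powR_ge0. Qed.

(** The power p - 1 is at most 1 when |a| <= 1 and at most the power p otherwise. Over a finite
    measure, an L^p gradient thus has an integrable image under [phip]. *)
Lemma phip_le a : `|phip p a| <= 1 + `|a| `^ p.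
Proof.
rewrite /phip normrM [`| _ `^ _|]ger0_norm ?powR_ge0//.
have [a1|/ltW a1] := leP `|a| 1.
  apply: (@le_trans _ _ 1); last by rewrite lerDl powR_ge0.
  rewrite mulr_ile1 ?powR_ge0//; first by rewrite normr_sg; case: eqP.
  apply: (@le_trans _ _ (1 `^ (p - 1))); last by rewrite powR1.
  by rewrite ge0_ler_powR ?nnegrE// subr_ge0 ltW.
apply: (@le_trans _ _ (`|a| `^ p)); last by rewrite lerDr.
apply: (@le_trans _ _ (`|a| `^ (p - 1))).
  by rewrite ler_piMl ?powR_ge0// normr_sg; case: eqP.
by rewrite ler_powR// gerBl.
Qed.

Lemma measurable_phip : measurable_fun setT (phip p).
Proof.
have pN0 : p - 1 != 0 by rewrite subr_eq0 gt_eqF.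
(* Since p - 1 is nonzero, 0 to the power p - 1 is 0, so only one of the two terms survives for each
   sign of a. *)
have -> : phip p = fun a => Num.max a 0 `^ (p - 1) - Num.max (- a) 0 `^ (p - 1).
  apply/funext => a; rewrite /phip; have [a0|a0|<-] := ltgtP 0 a.
  - rewrite gtr0_sg// mul1r gtr0_norm//.
    by rewrite (max_idPr _) ?oppr_le0 ?ltW// powR0// subr0.
  - by rewrite ltr0_sg// mulN1r ltr0_norm// (max_idPl _) ?oppr_ge0 ?ltW// powR0// sub0r.
  - by rewrite sgr0 mul0r oppr0 maxxx subrr.
by apply: measurable_funB; apply: (measurableT_comp (measurable_powR _));
  exact: measurable_maxr.
Qed.

Lemma phip_monotone (theta : R -> R) a b : {homo theta : x y / x <= y} ->
  0 <= phip p (b - a) * (theta b - theta a).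
Proof.
move=> nd; have [ab|/ltW ba] := leP a b.
  by rewrite mulr_ge0 ?phip_ge0 ?subr_ge0// nd.
rewrite -opprB phipN -(opprB (theta a)) mulrNN.
by rewrite mulr_ge0 ?phip_ge0 ?subr_ge0// nd.
Qed.

End phip.

(** * Testing the p-Laplacian against nondecreasing functions of u *)

Section Deltap_dissipative.
Context (d : measure_display) (T : measurableType d) (R : realType).
Variables (p : R) (m : R.-pker T ~> T) (nu : {measure set T -> \bar R}).
Variables (u w : T -> R).
Hypotheses (p1 : 1 < p) (rev : reversible m nu) (nufin : (nu setT < +oo)%E).
Hypothesis uw : Deltap p m nu u w.

Let meas_u : measurable_fun setT u.
Proof. by case: uw => -[]. Qed.

Let grad (z : T * T) : R := u z.2 - u z.1.

Let mgrad : measurable_fun setT grad.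
Proof.
by apply: measurable_funB; [exact: measurableT_comp meas_u measurable_snd|
  exact: measurableT_comp meas_u measurable_fst].
Qed.

Let I (f : T * T -> \bar R) := (\int[nu]_x \int[m x]_y f (x, y))%E.

Let IP := daniell_kernel m nu.

Let le_I (f g : T * T -> \bar R) : nonneg_measurable f -> nonneg_measurable g ->
  (forall z, f z <= g z)%E -> (I f <= I g)%E.
Proof.
move=> hf hg fg; apply: ge0_le_integral => //.
- by move=> x _; case: (nonneg_measurable_kernel m hf).
- by case: (nonneg_measurable_kernel m hf).
- by case: (nonneg_measurable_kernel m hg).
move=> x _; apply: ge0_le_integral => //.
- by move=> y _; case: hf.
- by case: (nonneg_measurable_section x hf).
- by case: (nonneg_measurable_section x hg).
Qed.

(** Common majorant: it dominates the flux times a test function bounded by K and, with K = 1, the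
    flux itself. *)
Let bound (K : R) (z : T * T) : \bar R := (K%:E * (1 + `|grad z| `^ p)%:E)%E.

Let bound_nonneg (K : R) : 0 <= K -> nonneg_measurable (bound K).
Proof.
move=> K0; split; last first.
  by move=> z; rewrite /bound mule_ge0// lee_fin addr_ge0 ?powR_ge0.
apply: measurable_funeM; apply/measurable_EFinP/measurable_funD => //.
apply: (measurableT_comp (measurable_powR _)).
exact: measurableT_comp.
Qed.

Let I_bound (K : R) : 0 <= K -> (I (bound K) < +oo)%E.
Proof.
move=> K0; have [ID IZ _] := IP.
have h1 : nonneg_measurable (fun _ : T * T => 1%E : \bar R) by split.
have hg : nonneg_measurable (fun z => (`|grad z| `^ p)%:E).
  split; last by move=> z; rewrite lee_fin powR_ge0.
  apply/measurable_EFinP/(measurableT_comp (measurable_powR _)).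
  exact: measurableT_comp.
have hs : nonneg_measurable (fun z => 1 + (`|grad z| `^ p)%:E)%E.
  split; last by move=> z; rewrite adde_ge0//; case: hg.
  by apply: emeasurable_funD => //; case: hg.
rewrite /I /bound; have := IZ K _ K0 hs; rewrite /= => ->.
rewrite lte_mul_pinfty//; have := ID _ _ h1 hg; rewrite /= => ->.
apply: lte_add_pinfty; last by case: uw.
under eq_integral => x _ do rewrite integral_cst// mul1e prob_kernel.
by rewrite integral_cst// mul1e.
Qed.

(** By reversibility the pairing equals minus one half of the double integral of phip(grad u)
    grad(theta o u), which is nonnegative by [phip_monotone]. Boundedness of theta makes the
    integrand [F] integrable. Its positive and negative parts are treated separately because the
    swap is available for nonnegative functions. *)
Lemma Deltap_dissipative (theta : R -> R) (K : R) :
  measurable_fun setT theta -> {homo theta : x y / x <= y} ->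
  (forall s, `|theta s| <= K) -> ip nu w (theta \o u) <= 0.
Proof.
move=> mtheta ndtheta thetaK.
have K0 : 0 <= K by rewrite (le_trans _ (thetaK 0)).
pose F (z : T * T) : R := phip p (grad z) * theta (u z.1).
have mphi : measurable_fun setT (phip p \o grad).
  exact: measurableT_comp (measurable_phip p1) mgrad.
have mF : measurable_fun setT F.
  apply: measurable_funM => //; apply: (measurableT_comp mtheta).
  exact: measurableT_comp meas_u measurable_fst.
pose Fp z := (Num.max (F z) 0)%:E; pose Fn z := (Num.max (- F z) 0)%:E.
have hFp : nonneg_measurable Fp.
  split; last by move=> z; rewrite lee_fin le_max lexx orbT.
  by apply/measurable_EFinP; exact: measurable_maxr.
have hFn : nonneg_measurable Fn.
  split; last by move=> z; rewrite lee_fin le_max lexx orbT.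
  apply/measurable_EFinP; apply: measurable_maxr => //.
  exact: measurable_funN.
have F_le z : `|F z| <= K * (1 + `|grad z| `^ p).
  rewrite normrM mulrC ler_pM//; exact: phip_le.
have Fp_le z : (Fp z <= bound K z)%E.
  rewrite /bound -EFinM lee_fin ge_max (le_trans (ler_norm _) (F_le z)) /=.
  by rewrite mulr_ge0// addr_ge0 ?powR_ge0.
have Fn_le z : (Fn z <= bound K z)%E.
  rewrite /bound -EFinM lee_fin ge_max (le_trans (ler_norm _))/= ?normrN//.
  by rewrite mulr_ge0// addr_ge0 ?powR_ge0.
have IFp : (I Fp < +oo)%E.
  exact: le_lt_trans (le_I hFp (bound_nonneg K0) Fp_le) (I_bound K0).
have IFn : (I Fn < +oo)%E.
  exact: le_lt_trans (le_I hFn (bound_nonneg K0) Fn_le) (I_bound K0).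
pose sw (f : T * T -> \bar R) z := f (z.2, z.1).
have mswap : measurable_fun setT (fun z : T * T => (z.2, z.1)).
  exact/measurable_fun_pair.
have hsw f : nonneg_measurable f -> nonneg_measurable (sw f).
  exact: (@nonneg_measurable_comp R _ _ _ _ (fun z : T * T => (z.2, z.1))).
have Isw f : nonneg_measurable f -> I (sw f) = I f.
  by move=> hf; rewrite /I [RHS](reversible_swap rev nufin hf).
(* F(x,y) + F(y,x) <= 0 and the double integral is invariant under the swap. *)
have IFpn : (I Fp <= I Fn)%E.
  have [ID _ _] := IP.
  have : (I (fun z => Fp z + sw Fp z) <= I (fun z => Fn z + sw Fn z))%E.
    apply: le_I => [| |z].
    - split; first by apply: emeasurable_funD; [case: hFp|case: (hsw _ hFp)].
      by move=> z; rewrite adde_ge0//; [case: hFp|case: (hsw _ hFp)].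
    - split; first by apply: emeasurable_funD; [case: hFn|case: (hsw _ hFn)].
      by move=> z; rewrite adde_ge0//; [case: hFn|case: (hsw _ hFn)].
    - rewrite /Fp /Fn /sw /= lee_fin.
      have : F z + F (z.2, z.1) <= 0.
        rewrite /F /grad /= -(opprB (u z.2)) phipN mulNr -mulrBr -oppr_ge0.
        by rewrite -mulrN opprB phip_monotone.
      move: (F z) (F (z.2, z.1)) => a b ab.
      rewrite /Order.max; case: (ltP a 0) => a0; case: (ltP b 0) => b0;
      by case: (ltP (- a) 0) => a1; case: (ltP (- b) 0) => b1; lra.
  rewrite /I (ID _ _ hFp (hsw _ hFp)) (ID _ _ hFn (hsw _ hFn)) -!/(I _).
  rewrite !Isw//.
  have : (0 <= I Fp)%E.
    by apply: integral_ge0 => x _; case: (nonneg_measurable_kernel m hFp).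
  have : (0 <= I Fn)%E.
    by apply: integral_ge0 => x _; case: (nonneg_measurable_kernel m hFn).
  case: (I Fp) IFp => [a _|//|//]; case: (I Fn) IFn => [b _|//|//] _ _.
  by rewrite -!EFinD !lee_fin; lra.
pose A x := (\int[m x]_y Fp (x, y))%E; pose B x := (\int[m x]_y Fn (x, y))%E.
have iA : nu.-integrable setT A.
  apply/integrableP; have [mA A0] := nonneg_measurable_kernel m hFp.
  split => //; rewrite (eq_integral A); first exact: IFp.
  by move=> x _; rewrite gee0_abs//; exact: A0.
have iB : nu.-integrable setT B.
  apply/integrableP; have [mB B0] := nonneg_measurable_kernel m hFn.
  split => //; rewrite (eq_integral B); first exact: IFn.
  by move=> x _; rewrite gee0_abs//; exact: B0.
have wE : {ae nu, forall x, setT x -> (w x * theta (u x))%:E = (A x - B x)%E}.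
  have hb := bound_nonneg (@ler01 R).
  have iC : nu.-integrable setT (fun x => \int[m x]_y bound 1 (x, y))%E.
    apply/integrableP; have [mC C0] := nonneg_measurable_kernel m hb.
    split => //; rewrite (eq_integral (fun x => \int[m x]_y bound 1 (x, y))%E).
      exact: I_bound.
    by move=> x _; exact: gee0_abs.
  (* For a.e. x the inner integral of [bound 1] is finite, so the flux is integrable for [m x], and
     the factor theta(u x), constant in y, can be moved inside. *)
  have := integrable_ae measurableT iC.
  case: uw => _ _ _; apply: filterS2 => x wx Cfin _.
  have iphi : (m x).-integrable setT (fun y => (phip p (u y - u x))%:E).
    apply/integrableP; split.
      apply/measurable_EFinP.
      exact: (measurableT_comp mphi (pair1_measurable x)).
    apply: le_lt_trans (_ : _ <= \int[m x]_y bound 1 (x, y))%E _; last first.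
      by have := Cfin Logic.I; rewrite fin_numElt => /andP[].
    apply: ge0_le_integral => //.
    - apply: measurableT_comp => //; apply/measurable_EFinP.
      exact: (measurableT_comp mphi (pair1_measurable x)).
    - by case: (nonneg_measurable_section x hb).
    - by move=> y _; rewrite /bound mul1e lee_fin phip_le.
  rewrite EFinM wx muleC -integralZl//.
  rewrite integralE; congr (_ - _)%E; apply: eq_integral => y _.
  - by rewrite funeposE /= -EFinM mulrC /Fp EFin_max.
  - by rewrite funenegE -EFinM -EFinN mulrC /Fn EFin_max.
rewrite /ip /Rintegral fine_le0//.
rewrite (ae_eq_integral (fun x => A x - B x)%E)//.
- rewrite integralB//; rewrite -/(I Fp) -/(I Fn) sube_le0//.
- apply/measurable_EFinP/measurable_funM; first by case: uw => _ [].
  exact: measurableT_comp.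
- by apply: emeasurable_funB; [exact: (measurable_int nu iA)|exact: (measurable_int nu iB)].
Qed.

(** The constants 1 and -1 are both bounded and nondecreasing, so both signs of the inequality
    hold. *)
Lemma Deltap_mean0 : ip nu w (fun=> 1) = 0.
Proof.
have Lw : L2 nu w by case: uw.
apply/eqP; rewrite eq_le; apply/andP; split.
  by apply: (@Deltap_dissipative (fun=> 1) 1) => // s; rewrite normr1.
have : ip nu w (fun=> -1) <= 0.
  by apply: (@Deltap_dissipative (fun=> -1) 1) => // s; rewrite normrN normr1.
have -> : (fun=> -1) = (fun=> -1 * 1) :> (T -> R) by apply/funext => x; rewrite mulr1.
by rewrite ipZr//; [rewrite mulN1r oppr_le0|exact: L2_cst].
Qed.

(** Truncation at levels -k and k is bounded and nondecreasing. At each x it equals u x as soon as k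
    exceeds |u x|, and the products are dominated by the integrable |w u|. *)
Lemma Deltap_le0 : ip nu w u <= 0.
Proof.
have [Lu Lw _ _] := uw.
pose theta (k : nat) (s : R) : R := Num.max (- k%:R) (Num.min s k%:R).
have mtheta k : measurable_fun setT (theta k).
  by apply: measurable_maxr => //; exact: measurable_minr.
have theta_le k s : `|theta k s| <= k%:R /\ `|theta k s| <= `|s|.
  have k0 := ler0n R k; rewrite /theta /Order.max /Order.min.
  by split; (case: (ltP s k%:R) => h1; [case: (ltP (- k%:R) s)|case: (ltP (- k%:R) k%:R)] => h2);
    rewrite ?ler_norml; try (case: (ger0P s) => h3); lra.
have h k : ip nu w (theta k \o u) <= 0.
  apply: (Deltap_dissipative (K := k%:R)) => //; last by move=> s; case: (theta_le k s).
  move=> s t st; rewrite /theta /Order.max /Order.min.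
  by case: (ltP s k%:R) => h1; case: (ltP t k%:R) => h2;
    case: ltP => h3; case: ltP => h4; lra.
have iwu : nu.-integrable setT (EFin \o (fun x => `|w x * u x|)).
  by have := integrable_abse (integrable_mulL2 Lw Lu).
have [] := @dominated_convergence _ _ _ nu setT measurableT
  (fun k x => (w x * theta k (u x))%:E) (fun x => (w x * u x)%:E)
  (EFin \o (fun x => `|w x * u x|)).
- move=> k; apply/measurable_EFinP/measurable_funM; first exact: L2_measurable Lw.
  exact: measurableT_comp.
- by apply/measurable_EFinP/measurable_funM; [exact: L2_measurable Lw|exact: L2_measurable Lu].
- apply: aeW => x _; apply: cvg_near_cst.
  exists (Num.bound `|u x|) => // k /= bk; congr (_ * _)%:E.
  have uk : `|u x| < k%:R.
    by apply: lt_le_trans (archi_boundP (normr_ge0 _)) _; rewrite ler_nat.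
  move: uk; rewrite ltr_norml => /andP[uk1 uk2].
  by rewrite /theta (min_idPl (ltW uk2)) (max_idPr (ltW uk1)).
- exact: iwu.
- apply: aeW => x k _ /=; rewrite lee_fin !normrM ler_wpM2l//.
  by case: (theta_le k (u x)).
move=> _ _ cvg; rewrite /ip /Rintegral fine_le0//.
apply: (cvge_le _ cvg); apply: nearW => k.
have Lk : L2 nu (theta k \o u).
  apply: (L2_le _ Lu Lu); first exact: measurableT_comp.
  move=> x /=; have [_] := theta_le k (u x).
  rewrite -(ler_pXn2r (n := 2)) ?nnegrE// !real_normK ?num_real//.
  by have := sqr_ge0 (u x); lra.
by have := L2innerE Lw Lk; rewrite /L2inner /= => ->; rewrite lee_fin h.
Qed.

End Deltap_dissipative.

(** * Passing from nu2 to nu1 *)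

Section density.
Context (d : measure_display) (T : measurableType d) (R : realType).
Variables (nu1 nu2 : {measure set T -> \bar R}) (mu : T -> R).
Hypothesis mmu : measurable_fun setT mu.
Hypothesis nu2E : forall A, measurable A ->
  nu2 A = (\int[nu1]_(x in A) (mu x)%:E)%E.

Lemma density_finite (M : R) : {ae nu1, forall x, `|mu x| <= M} ->
  (nu1 setT < +oo)%E -> (nu2 setT < +oo)%E.
Proof.
move=> muM nu1fin; rewrite nu2E//.
have iM : nu1.-integrable setT (cst M%:E).
  apply/integrableP; split => //=.
  by rewrite (integral_cst nu1 measurableT `|M|%:E) lte_mul_pinfty.
have /integrable_fin_num : nu1.-integrable setT (EFin \o mu).
  apply/integrableP; split; first exact/measurable_EFinP.
  case/integrableP : iM => _; apply: le_lt_trans.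
  apply: ae_ge0_le_integral => //.
  - by apply: measurableT_comp => //; exact/measurable_EFinP.
  - by apply: filterS muM => x xM _ /=; rewrite lee_fin (le_trans xM)// ler_norm.
by move=> /(_ measurableT); rewrite fin_numElt => /andP[].
Qed.

Lemma integral_density_EFin : {ae nu1, forall x, 0 <= mu x} ->
  forall h : T -> R, measurable_fun setT h ->
  (\int[nu2]_x (h x)%:E = \int[nu1]_x (mu x * h x)%:E)%E.
Proof.
(* [mu] is nonnegative only almost everywhere, so a version nonnegative everywhere replaces it.
   Multiplying by it commutes with positive and negative parts, hence h needs no integrability. *)
move=> mu0 h mh; pose rho x := Num.max (mu x) 0.
have mrho : measurable_fun setT rho by exact: measurable_maxr.
have rho0 x : 0 <= rho x by rewrite le_max lexx orbT.
have rhoE : {ae nu1, forall x, mu x = rho x}.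
  by apply: filterS mu0 => x x0; rewrite /rho (max_idPl x0).
have nu2rho A : measurable A -> nu2 A = (\int[nu1]_(x in A) (rho x)%:E)%E.
  move=> mA; rewrite nu2E//; apply: ae_eq_integral => //.
  - exact/measurable_EFinP/measurable_funTS.
  - exact/measurable_EFinP/measurable_funTS.
  - by apply: filterS rhoE => x -> _.
rewrite [RHS](ae_eq_integral (fun x => (h x * rho x)%:E))//; last 3 first.
- exact/measurable_EFinP/measurable_funM.
- exact/measurable_EFinP/measurable_funM.
- by apply: filterS rhoE => x -> _; rewrite mulrC.
have mhE : measurable_fun setT (EFin \o h) by exact/measurable_EFinP.
rewrite integralE [RHS]integralE.
rewrite !(integral_density mrho rho0 nu2rho); last 2 first.
- by split; [exact: measurable_funeneg|].
- by split; [exact: measurable_funepos|].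
congr (_ - _)%E; apply: eq_integral => x _.
- by rewrite !funeposE EFinM maxe_pMl ?lee_fin// mul0e.
- by rewrite !funenegE EFinM -mulNe maxe_pMl ?lee_fin// mul0e.
Qed.

End density.

(** * Subgradients of the total variation functional and the full operator *)

Section opA_dissipative.
Context (d : measure_display) (T : measurableType d) (R : realType).
Variables (m : R.-pker T ~> T) (nu : {measure set T -> \bar R}).
Hypothesis nufin : (nu setT < +oo)%E.

Lemma F1_cst (c : R) : F1 m nu (fun=> c) = 0%E.
Proof.
rewrite /F1 integral0_eq ?mule0// => x _; rewrite integral0_eq// => y _.
by rewrite subrr normr0.
Qed.

Lemma F1_ge0 (u : T -> R) : (0 <= F1 m nu u)%E.
Proof.
rewrite /F1 mule_ge0 ?lee_fin ?invr_ge0// integral_ge0// => x _.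
by rewrite integral_ge0.
Qed.

Lemma F1D_cst (u : T -> R) (c : R) : F1 m nu (fun x => u x + c) = F1 m nu u.
Proof.
rewrite /F1; congr (_ * _)%E; apply: eq_integral => x _.
by apply: eq_integral => y _; congr (`| _ |%:E); ring.
Qed.

Lemma subdiff_F1_le (u v : T -> R) : subdiff (F1 m nu) nu u v ->
  (F1 m nu u <= (ip nu v u)%:E)%E.
Proof.
case=> Lu Lv /(_ (fun=> 0) (L2_cst 0 nufin)); rewrite F1_cst.
have -> : (fun x => 0 - u x) = (fun x => -1 * u x) by apply/funext => x; ring.
rewrite L2innerE//; last exact: L2Z.
by rewrite ipZr// mulN1r EFinN sube_le0.
Qed.

Lemma subdiff_F1_mean0 (u v : T -> R) : subdiff (F1 m nu) nu u v ->
  ip nu v (fun=> 1) = 0.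
Proof.
move=> uv; have [Lu Lv sub] := uv.
have L1 := L2_cst 1 nufin.
(* [F1] is invariant under adding constants, so it cancels from the subdifferential inequality,
   provided it is finite; testing with 0 has already shown that. *)
have Ffin : F1 m nu u \is a fin_num.
  by rewrite ge0_fin_numE ?F1_ge0// (le_lt_trans (subdiff_F1_le uv))// ltry.
have H (c : R) : c * ip nu v (fun=> 1) <= 0.
  have := sub _ (L2D Lu (L2_cst c nufin)); rewrite F1D_cst.
  have -> : (fun x => u x + c - u x) = (fun x => c * 1) by apply/funext => x; ring.
  rewrite L2innerE//; last exact: L2Z.
  by rewrite ipZr// -{2}[F1 m nu u]adde0 leeD2lE// lee_fin.
by have := H 1; have := H (-1); lra.
Qed.

End opA_dissipative.

Lemma opA_dissipative (d : measure_display) (T : measurableType d) (R : realType)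
    (p : R) (m1 m2 : R.-pker T ~> T) (nu1 nu2 : {measure set T -> \bar R})
    (mu : T -> R) (lam : R) (u v : T -> R) :
  1 < p -> reversible m2 nu2 -> measurable_fun setT mu ->
  (forall A, measurable A -> nu2 A = (\int[nu1]_(x in A) (mu x)%:E)%E) ->
  {ae nu1, forall x, 0 <= mu x} ->
  (nu1 setT < +oo)%E -> (nu2 setT < +oo)%E ->
  poincare 2 m1 nu1 lam -> opA p m1 m2 nu1 nu2 mu u v ->
  ip nu1 v (fun=> 1) = 0 /\
  lam * nrm nu1 (fun x => u x - mean nu1 u) <= ip nu1 v u.
Proof.
move=> p1 rev mmu nu2E mu0 fin1 fin2 [lam0 poinc] [Lu Lv [v1 [w [vE uv1 uw]]]].
have L1 := L2_cst 1 fin1.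
have {uv1} : subdiff (F1 m1 nu1) nu1 u v1.
  by move: uv1; rewrite /Delta1; under eq_fun => x do rewrite opprK.
move=> uv1; have Lv1 : L2 nu1 v1 by case: uv1.
have [_ Lw _ _] := uw.
(* The factor [mu] is absorbed as the density of nu2. The difference v1 - v, known to be in L2, is
   used in place of its a.e. equal mu w. *)
have transfer f : L2 nu1 f -> ip nu1 v f = ip nu1 v1 f - ip nu2 w f.
  move=> Lf; suff : ip nu1 (fun x => v1 x - v x) f = ip nu2 w f.
    by rewrite ipBl//; lra.
  rewrite /ip /Rintegral; congr fine; rewrite (integral_density_EFin mmu nu2E)//.
    apply: ae_eq_integral => //.
    - by apply/measurable_EFinP/measurable_funM;
        [exact: L2_measurable (L2B Lv1 Lv)|exact: L2_measurable Lf].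
    - apply/measurable_EFinP/measurable_funM => //.
      by apply/measurable_funM; [exact: L2_measurable Lw|exact: L2_measurable Lf].
    - by apply: filterS vE => x -> _; congr (_%:E); ring.
  by apply/measurable_funM; [exact: L2_measurable Lw|exact: L2_measurable Lf].
split.
  rewrite transfer// (subdiff_F1_mean0 fin1 uv1).
  by rewrite (Deltap_mean0 p1 rev fin2 uw) subr0.
rewrite transfer//; apply: (@le_trans _ _ (ip nu1 v1 u)); last first.
  by rewrite lerBrDr gerDl (Deltap_le0 p1 rev fin2 uw).
rewrite -lee_fin (le_trans _ (subdiff_F1_le fin1 uv1))//.
have Lum : L2 nu1 (fun x => u x - mean nu1 u) by apply: L2B => //; exact: L2_cst.
rewrite EFinM -(L2norm_nrm Lum); apply: poinc; first exact: L2_measurable Lu.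
case: Lu => _; under eq_integral => x _ do
  rewrite -(real_normK (num_real _)) -powR_mulrn//.
by [].
Qed.

(** * Decay along the flow *)

Section local_to_global.
Context (R : realType).
Implicit Types (a b : R) (y G : R -> R).

(** Continuous induction: at the supremum c of the points reachable from a, the local property links
    a point just left of c to a point right of c, unless c = b. *)
Lemma cousin (P : R -> R -> Prop) a b : a <= b ->
  (forall r s t, P r s -> P s t -> P r t) ->
  (forall t, a <= t <= b -> exists2 del : R, 0 < del &
    forall s s', a <= s -> s <= t -> t <= s' -> s' <= b ->
      t - s < del -> s' - t < del -> P s s') ->
  P a b.
Proof.
move=> ab Ptrans Ploc.
pose S := [set x | a <= x <= b /\ P a x].
have Sa : S a.
  split; first by rewrite lexx.
  have [del del0] := Ploc a ltac:(by rewrite lexx ab).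
  by apply; rewrite ?lexx// subrr.
have ubS : ubound S b by move=> x [/andP[]].
have hubS : has_ubound S by exists b.
have supS : has_sup S by split; [exists a|].
pose c := sup S.
have ac : a <= c by exact: ub_le_sup.
have cb : c <= b by apply: ge_sup => //; exists a.
have [del del0 Pc] := Ploc c ltac:(by rewrite ac cb).
have [x [/andP[ax xb] Pax] cx] := sup_adherent del0 supS.
have xc : x <= c by apply: ub_le_sup => //; split => //; rewrite ax xb.
pose c' := Num.min b (c + del / 2).
have cc' : c <= c' by rewrite le_min cb lerDl divr_ge0// ltW.
have c'b : c' <= b by rewrite ge_min lexx.
have c'c : c' <= c + del / 2 by rewrite ge_min lexx orbT.
have Pac' : P a c'.
  apply: Ptrans Pax _; apply: Pc => //; first by rewrite -/c in cx; lra.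
  by move: c'c; lra.
have : c' <= c.
  apply: ub_le_sup => //.
  by split => //; rewrite (le_trans ac cc') c'b.
rewrite /c' ge_min => /orP[bc|]; last by lra.
by move: Pac'; rewrite /c' (min_idPl _)//; lra.
Qed.

(** This plays the part of integrating a differential inequality: the errors e (G s' - G s)
    telescope, so their total is e (G b - G a), and e is arbitrary. *)
Lemma local_growth y G (K : R) a b : a <= b ->
  (forall e, 0 < e -> forall t, a <= t <= b -> exists2 del : R, 0 < del &
    forall s s', a <= s -> s <= t -> t <= s' -> s' <= b -> s < s' ->
      t - s < del -> s' - t < del ->
      y s' - y s <= K * (s' - s) + e * (G s' - G s)) ->
  y b - y a <= K * (b - a).
Proof.
move=> ab loc; apply/ler_addgt0Pr => e e0.
(* The added 1 keeps the divisor positive when G b = G a. *)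
pose D := `|G b - G a| + 1.
have D0 : 0 < D by rewrite ltr_pwDr.
have eD0 : 0 < e / D by rewrite divr_gt0.
have : y b - y a <= K * (b - a) + e / D * (G b - G a).
  apply: (@cousin (fun s s' => y s' - y s <= K * (s' - s) + e / D * (G s' - G s))) => //.
    by move=> s t r; lra.
  move=> t /(loc _ eD0)[del del0 H]; exists del => // s s' as_ st ts' s'b ds ds'.
  have [ss'|] := ltP s s'; first exact: H.
  move=> s's; have -> : s' = s by apply/eqP; rewrite eq_le s's (le_trans st ts').
  by rewrite !subrr !mulr0 addr0.
move=> /le_trans; apply; rewrite lerD2l mulrAC ler_pdivrMr//.
by rewrite ler_pM2l// /D (le_trans (ler_norm _))// lerDl.
Qed.

(* The hypothesis is y' <= -2 lam sqrt(y) for y = N^2, i.e. N' <= -lam while N > 0. *)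
Lemma linear_decay (N : R -> R) (lam : R) a b : 0 < lam -> a <= b ->
  (forall t, a <= t <= b -> forall e, 0 < e -> exists2 del : R, 0 < del &
    forall s, a <= s <= b -> `|s - t| < del -> `|N s - N t| < e) ->
  (forall s t, a <= s -> s < t -> t <= b ->
    N t ^+ 2 - N s ^+ 2 <= - (2 * lam * N t) * (t - s)) ->
  (forall s, a <= s <= b -> N b <= N s) ->
  0 < N b -> N b <= N a - lam * (b - a).
Proof.
move=> lam0 ab cont decr low Nb0.
suff : N b - N a <= - lam * (b - a) by lra.
apply: (@local_growth N id) => // e e0 t tab.
(* With this tolerance lam (N s - N s') is at most 2 e N b, which e (N s + N s') absorbs because N
   >= N b. *)
have e'0 : 0 < e * N b / lam by rewrite divr_gt0// mulr_gt0.
have [del del0 Hdel] := cont t tab _ e'0; exists del => //.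
move=> s s' as_ st ts' s'b ss' ds ds'.
have sI : a <= s <= b by rewrite as_ (le_trans st (le_trans ts' s'b)).
have s'I : a <= s' <= b by rewrite s'b (le_trans as_ (le_trans st ts')).
have h1 : `|N s - N t| < e * N b / lam.
  by apply: Hdel => //; rewrite distrC ger0_norm ?subr_ge0.
have h2 : `|N s' - N t| < e * N b / lam.
  by apply: Hdel => //; rewrite ger0_norm ?subr_ge0.
have h3 := decr _ _ as_ ss' s'b.
have l1 := low _ sI; have l2 := low _ s'I.
have h4 : lam * (N s - N s') <= 2 * (e * N b).
  move: h1 h2; rewrite !ltr_norml => /andP[h11 h12] /andP[h21 h22].
  have : N s - N s' <= 2 * (e * N b / lam) by lra.
  by rewrite -(ler_pM2l lam0) [leRHS]mulrCA (mulrCA lam) divff ?gt_eqF// mulr1.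
rewrite /=; move: (s' - s) (subr_gt0 s s') h3 => h; rewrite ss' => h0 h3.
have S0 : 0 < N s + N s' by lra.
(* Multiplying by N s + N s' > 0 restores the difference of squares. Replacing 2 N s' by N s + N s'
   in the rate costs lam h (N s - N s'), which [h4] controls. *)
suff : 0 <= (N s + N s') * (N s - N s' - lam * h + e * h).
  by rewrite pmulr_rge0//; lra.
have k1 : h * (lam * (N s - N s')) <= h * (2 * (e * N b)) by rewrite ler_pM2l.
have k2 : e * h * (2 * N b) <= e * h * (N s + N s').
  by rewrite ler_pM2l ?mulr_gt0//; lra.
by nra.
Qed.

End local_to_global.

Lemma ae_le_integral (d : measure_display) (T : measurableType d) (R : realType)
    (nu : {measure set T -> \bar R}) (D : set T) (f h : T -> \bar R) :
  measurable D -> measurable_fun D f -> measurable_fun D h ->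
  {ae nu, forall x, D x -> (f x <= h x)%E} ->
  (\int[nu]_(x in D) f x <= \int[nu]_(x in D) h x)%E.
Proof.
move=> mD mf mh fh; rewrite [leLHS]integralE [leRHS]integralE; apply: leeB.
- apply: ae_ge0_le_integral => //; try exact: measurable_funepos.
  by apply: filterS fh => x fhx /fhx; rewrite !funeposE => ?; exact: le_max2.
- apply: ae_ge0_le_integral => //; try exact: measurable_funeneg.
  by apply: filterS fh => x fhx /fhx; rewrite !funenegE => ?; apply: le_max2 => //; rewrite leeN2.
Qed.

Lemma lebesgue_measure_itvcc (R : realType) (s t : R) : s <= t ->
  lebesgue_measure (`[s, t] : set R) = (t - s)%:E.
Proof.
move=> st; rewrite lebesgue_measure_itv/= lte_fin; case: ltP => // ts.
by rewrite (_ : t = s) ?subrr//; apply/eqP; rewrite eq_le ts.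
Qed.

Lemma integrable_cst_itvcc (R : realType) (s t a : R) :
  lebesgue_measure.-integrable `[s, t] (EFin \o cst a).
Proof.
apply: continuous_compact_integrable; first exact: segment_compact.
by apply: continuous_subspaceT => x; exact: cst_continuous.
Qed.

Lemma ae_lebesgueS (R : realType) (P Q : R -> Prop) :
  (forall x, P x -> Q x) -> {ae lebesgue_measure, forall x, P x} ->
  {ae lebesgue_measure, forall x, Q x}.
Proof.
by move=> PQ; apply: filterS => //; exact: (ae_filter_ringOfSetsType lebesgue_measure).
Qed.

(** * Distance to the mean along the flow *)

Section gradient_flow_decay.
Local Notation leb := lebesgue_measure.
Context (d : measure_display) (T : measurableType d) (R : realType).
Variables (nu : {measure set T -> \bar R}) (lam : R) (u g : R -> T -> R).
Implicit Types (r s t e a b low : R) (phi : T -> R).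
Hypotheses (nufin : (nu setT < +oo)%E) (lam0 : 0 < lam).
Hypothesis Lu : forall t, 0 <= t -> L2 nu (u t).
Hypothesis ucont : forall t, 0 <= t -> forall e : R, 0 < e ->
  exists2 delta : R, 0 < delta & forall s, 0 <= s -> `|s - t| < delta ->
    nrm nu (fun x => u s x - u t x) < e.
Hypothesis uder : W12loc_deriv nu u g.
Hypothesis dissip : {ae lebesgue_measure, forall t : R, 0 < t ->
  [/\ L2 nu (g t), ip nu (g t) (fun=> 1) = 0 &
      lam * nrm nu (fun x => u t x - mean nu (u t)) <= - ip nu (g t) (u t)]}.

Let L1 := L2_cst 1 nufin.
Let k t := nrm nu (g t).

Let measurable_k s t : 0 < s -> measurable_fun `[s, t] k.
Proof.
move=> s0; have [_ mk _ _] := uder.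
apply: measurable_funS mk => // r /=; rewrite !in_itv/= andbT => /andP[sr _].
exact: lt_le_trans sr.
Qed.

Let integrable_k s t : 0 < s -> s < t -> leb.-integrable `[s, t] (EFin \o k).
Proof.
move=> s0 st; have mk := @measurable_k s t s0.
(* k <= 1 + k^2, and k^2 is integrable on compact intervals of positive times. *)
have i1 := @integrable_cst_itvcc R s t 1.
have i2 : leb.-integrable `[s, t] (fun r => (k r ^+ 2)%:E).
  apply/integrableP; split; first exact/measurable_EFinP/measurable_funX.
  have [_ _ k2 _] := uder; have := k2 s t s0 st; apply: le_lt_trans.
  by under eq_integral => r _ do rewrite gee0_abs ?lee_fin ?sqr_ge0//.
apply: (le_integrable _ _ _ (integrableD _ i1 i2)) => //.
  exact/measurable_EFinP.
move=> r _ /=; rewrite lee_fin [leRHS]ger0_norm ?addr_ge0 ?sqr_ge0//.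
by rewrite ler_norml; apply/andP; split; nra.
Qed.

Let weak phi s t : L2 nu phi -> 0 < s -> s < t ->
  (ip nu (fun x => u t x - u s x) phi)%:E =
  (\int[leb]_(r in `[s, t]) L2inner nu (g r) phi)%E.
Proof.
move=> Lphi s0 st; have [_ _ _ /(_ phi Lphi s t s0 st)[_ <-]] := uder.
by rewrite L2innerE//; apply: L2B; apply: Lu; rewrite ltW// (lt_trans s0).
Qed.

Let measurable_inner phi s t : L2 nu phi -> 0 < s -> s < t ->
  measurable_fun `[s, t] (fun r => L2inner nu (g r) phi).
Proof.
move=> Lphi s0 st; have [_ _ _ /(_ phi Lphi s t s0 st)[i _]] := uder.
exact: (measurable_int leb i).
Qed.

Let ip1_const s t : 0 < s -> s < t -> ip nu (u t) (fun=> 1) = ip nu (u s) (fun=> 1).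
Proof.
move=> s0 st; have t0 := lt_trans s0 st.
have Ls := Lu (ltW s0); have Lt := Lu (ltW t0).
apply/eqP; rewrite -subr_eq0 -ipBl//; apply/eqP.
apply: EFin_inj; rewrite weak//.
rewrite (ae_eq_integral (cst 0%E))//; [by rewrite integral0|exact: measurable_inner|].
apply: ae_lebesgueS dissip => r hr /=; rewrite in_itv/= => /andP[sr _].
by have [Lg g1 _] := hr (lt_le_trans s0 sr); rewrite L2innerE// g1.
Qed.

(** Constancy at positive times follows from the mean-zero velocity; continuity in L2 carries it to
    time 0. *)
Lemma mean_const t : 0 <= t -> mean nu (u t) = mean nu (u 0).
Proof.
rewrite le_eqVlt => /predU1P[<-//|t0].
suff : ip nu (u t) (fun=> 1) = ip nu (u 0) (fun=> 1).
  rewrite /ip /Rintegral /mean => E; congr (_ * _); move: E.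
  by under eq_integral => x _ do rewrite mulr1;
     under [in RHS]eq_integral => x _ do rewrite mulr1.
apply/eqP; rewrite -subr_eq0 -normr_le0; apply/ler_addgt0Pr => e e0; rewrite add0r.
(* The added 1 covers the case of the zero measure. *)
pose D := nrm nu (fun=> 1) + 1.
have D0 : 0 < D by rewrite ltr_wpDl// nrm_ge0.
have [del del0 H] := ucont (lexx 0) (divr_gt0 e0 D0).
pose s := Num.min (t / 2) (del / 2).
have s0 : 0 < s by rewrite lt_min !divr_gt0.
have st : s < t by rewrite gt_min; apply/orP; left; lra.
have sdel : `|s - 0| < del.
  by rewrite subr0 gtr0_norm// gt_min; apply/orP; right; lra.
have Ls := Lu (ltW s0); have L0 := Lu (lexx 0).
rewrite (ip1_const s0 st) -ipBl//.
apply: le_trans (ip_le_nrm (L2B Ls L0) L1) _.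
rewrite -[leRHS](divfK (lt0r_neq0 D0)).
apply: ler_pM; rewrite ?nrm_ge0//; last by rewrite lerDl.
by apply/ltW/H => //; exact: ltW.
Qed.

Let c := mean nu (u 0).
Let N t := nrm nu (fun x => u t x - c).

Let LN t : 0 <= t -> L2 nu (fun x => u t x - c).
Proof. by move=> t0; apply: L2B; [exact: Lu|exact: L2_cst]. Qed.

Let N_lip s t : 0 <= s -> 0 <= t ->
  `|N s - N t| <= nrm nu (fun x => u s x - u t x).
Proof.
move=> s0 t0; have Lc := L2_cst c nufin.
have h1 := nrm_triangle (Lu s0) (Lu t0) Lc.
have h2 := nrm_triangle (Lu t0) (Lu s0) Lc.
rewrite ler_norml -/(N s) -/(N t) in h1 h2 *; rewrite (nrm_distC _ (u t)) in h2.
by apply/andP; split; lra.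
Qed.

Lemma dist_mean_continuous t : 0 <= t -> forall e, 0 < e ->
  exists2 del : R, 0 < del & forall s, 0 <= s -> `|s - t| < del -> `|N s - N t| < e.
Proof.
move=> t0 e e0; have [del del0 H] := ucont t0 e0; exists del => // s s0 st.
exact: le_lt_trans (N_lip s0 t0) (H _ s0 st).
Qed.

(* The chain rule for N^2 is replaced by
   N(t)^2 - N(s)^2 = <u(t) - u(s), u(s) + u(t) - 2c>
   = int_s^t <g(r), u(s) + u(t) - 2c> dr,
   which avoids the measurability of r |-> <g(r), u(r)>. *)
Let increment s t e low : 0 < s -> s < t ->
  (forall r, s <= r <= t -> [/\ low <= N r, nrm nu (fun x => u s x - u r x) <= e &
     nrm nu (fun x => u t x - u r x) <= e]) ->
  N t ^+ 2 - N s ^+ 2 <=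
    - (2 * lam * low) * (t - s) + 2 * e * \int[leb]_(r in `[s, t]) k r.
Proof.
move=> s0 st H; have t0 := lt_trans s0 st.
have Ls := LN (ltW s0); have Lt := LN (ltW t0).
have Lus := Lu (ltW s0); have Lut := Lu (ltW t0); have Lts := L2B Lut Lus.
pose phi x := (u t x - c) + (u s x - c).
have Lphi : L2 nu phi by exact: L2D.
have -> : N t ^+ 2 - N s ^+ 2 = ip nu (fun x => u t x - u s x) phi.
  have tsE : (fun x => u t x - u s x) = (fun x => (u t x - c) - (u s x - c)).
    by apply/funext => x; ring.
  have /= e1 := ipBl Lt Ls Lt; have /= e2 := ipBl Lt Ls Ls.
  have /= e3 := ipDr Lts Lt Ls; rewrite -tsE in e1 e2.
  rewrite !nrm_sqr// [RHS]e3 e1 e2.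
  by rewrite (ipC _ (fun x => u s x - c) (fun x => u t x - c)); ring.
have ik := integrable_k s0 st.
have icst := @integrable_cst_itvcc R s t.
have ik2 : leb.-integrable `[s, t] (EFin \o (fun r => 2 * e * k r)).
  by apply: (integrableZl _ (2 * e) ik).
have -> : - (2 * lam * low) * (t - s) + 2 * e * \int[leb]_(r in `[s, t]) k r =
    \int[leb]_(r in `[s, t]) (- (2 * lam * low) + 2 * e * k r).
  have iZ : \int[leb]_(r in `[s, t]) (2 * e * k r) =
      2 * e * \int[leb]_(r in `[s, t]) k r by apply: RintegralZl.
  rewrite (RintegralD _ (icst (- (2 * lam * low))) ik2)// iZ; congr (_ + _).
  rewrite Rintegral_cst//; congr (_ * _).
  exact: (congr1 fine (esym (lebesgue_measure_itvcc (ltW st)))).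
rewrite -lee_fin weak// /Rintegral fineK; last first.
  by apply: integrable_fin_num => //; exact: (integrableD _ (icst _) ik2).
apply: ae_le_integral => //.
- exact: measurable_inner.
- apply/measurable_EFinP/measurable_funD => //; apply: measurable_funM => //.
  exact: measurable_k.
apply: ae_lebesgueS dissip => r hr /=; rewrite in_itv/= => /andP[sr rt].
have r0 := lt_le_trans s0 sr.
have [Lg g1 gu] := hr r0; have Lr := LN (ltW r0); have Lur := Lu (ltW r0).
have [lowr Hs Ht] := H r ltac:(by rewrite sr rt).
rewrite L2innerE// lee_fin.
(* Recentring at u r: the first term gives the dissipation, the constant pairs to 0 with the
   mean-zero velocity, and each of the two differences costs at most e k(r) by Cauchy-Schwarz. *)
have -> : phi = fun x => (2 * u r x + (- (2 * c)) * 1) +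
    ((u t x - u r x) + (u s x - u r x)).
  by apply/funext => x; rewrite /phi; ring.
have La : L2 nu (fun x => 2 * u r x) by exact: L2Z.
have Lb : L2 nu (fun x : T => (- (2 * c)) * 1) by exact: L2Z.
have Lc1 : L2 nu (fun x => u t x - u r x) by exact: L2B.
have Lc2 : L2 nu (fun x => u s x - u r x) by exact: L2B.
have /= e1 := ipDr Lg (L2D La Lb) (L2D Lc1 Lc2).
have /= e2 := ipDr Lg La Lb; have /= e3 := ipDr Lg Lc1 Lc2.
have /= e4 := ipZr 2 Lg Lur; have /= e5 := ipZr (- (2 * c)) Lg L1.
rewrite e1 e2 e3 e4 e5 g1.
have c1 := ip_le_nrm Lg Lc1; have c2 := ip_le_nrm Lg Lc2.
have gN : lam * low <= - ip nu (g r) (u r).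
  apply: le_trans gu; rewrite ler_pM2l// (le_trans lowr)//.
  by rewrite mean_const// ltW.
have k0 : 0 <= k r by exact: nrm_ge0.
have d1 : ip nu (g r) (fun x => u t x - u r x) <= k r * e.
  by rewrite (le_trans (ler_norm _))// (le_trans c1)// ler_wpM2l.
have d2 : ip nu (g r) (fun x => u s x - u r x) <= k r * e.
  by rewrite (le_trans (ler_norm _))// (le_trans c2)// ler_wpM2l.
lra.
Qed.

(** On short intervals the error in [increment] is e times an increment of the primitive of k, so
    [local_growth] removes it. *)
Let decrease a b low : 0 < a -> a <= b ->
  (forall r, a <= r <= b -> low <= N r) ->
  N b ^+ 2 - N a ^+ 2 <= - (2 * lam * low) * (b - a).
Proof.
move=> a0 ab H.
apply: (@local_growth R (fun t => N t ^+ 2)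
  (fun t => \int[leb]_(r in `[a, t]) k r)) => // e e0 t /andP[at_ tb].
have t0 := lt_le_trans a0 at_.
(* Two states within e/4 of u t are within e/2 of each other, and [increment] doubles that to e. *)
have e4 : 0 < e / 4 by rewrite divr_gt0.
have [del del0 Hdel] := ucont (ltW t0) e4; exists del => //.
move=> s s' as_ st ts' s'b ss' ds ds'.
have s0 := lt_le_trans a0 as_.
have near r : s <= r <= s' -> nrm nu (fun x => u r x - u t x) <= e / 4.
  move=> /andP[sr rs']; apply/ltW/Hdel; first by rewrite ltW// (lt_le_trans s0).
  by rewrite ltr_norml; apply/andP; split; lra.
have dist r r' : s <= r <= s' -> s <= r' <= s' ->
    nrm nu (fun x => u r x - u r' x) <= e / 2.
  move=> hr hr'; have n1 := near _ hr; have n2 := near _ hr'.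
  have /andP[sr _] := hr; have /andP[sr' _] := hr'.
  have := nrm_triangle (Lu (ltW (lt_le_trans s0 sr))) (Lu (ltW t0))
    (Lu (ltW (lt_le_trans s0 sr'))).
  by rewrite (nrm_distC _ (u t)); lra.
have := @increment s s' (e / 2) low s0 ss'.
have -> : 2 * (e / 2) = e by lra.
have -> : \int[leb]_(r in `[s, s']) k r =
    \int[leb]_(r in `[a, s']) k r - \int[leb]_(r in `[a, s]) k r.
  have as' : a < s' by exact: le_lt_trans ss'.
  have ik := integrable_k a0 as'.
  rewrite (Rintegral_itvB ik) ?bnd_simp//; last exact: ltW.
  rewrite Rintegral_itv_obnd_cbnd//.
  by apply: integrableS ik => //; apply: subset_itv; rewrite bnd_simp.
apply => r rI; split.
- by apply: H; move: rI => /andP[sr rs']; rewrite (le_trans as_ sr) (le_trans rs' s'b).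
- by apply: dist => //; rewrite lexx ltW.
- by apply: dist => //; rewrite lexx ltW.
Qed.

(** The trivial lower bound 0 suffices here. Monotonicity then lets [decay_pos] use N at the right
    end as the lower bound [low]. *)
Let N_noninc s t : 0 < s -> s <= t -> N t <= N s.
Proof.
move=> s0 st; have := @decrease s t 0 s0 st (fun r _ => nrm_ge0 nu _).
rewrite mulr0 oppr0 mul0r subr_le0.
by rewrite ler_pXn2r// nnegrE nrm_ge0.
Qed.

Let decay_pos a b : 0 < a -> a <= b -> 0 < N b -> N b <= N a - lam * (b - a).
Proof.
move=> a0 ab Nb0; apply: linear_decay => //.
- move=> t /andP[at_ tb] e e0.
  have [del del0 H] := dist_mean_continuous (le_trans (ltW a0) at_) e0.
  exists del => // s /andP[as_ _]; apply: H; exact: le_trans (ltW a0) as_.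
- move=> s t as_ st tb; apply: decrease => //; [exact: lt_le_trans as_|exact: ltW|].
  move=> r /andP[sr rt]; apply: N_noninc => //.
  exact: lt_le_trans (lt_le_trans a0 as_) sr.
- by move=> s /andP[as_ sb]; apply: N_noninc => //; exact: lt_le_trans as_.
Qed.

Lemma dist_mean_decay t : 0 < t -> N t <= Num.max (N 0 - lam * t) 0.
Proof.
move=> t0; rewrite le_max; have [Nt0|Nt0] := leP (N t) 0; first by rewrite orbT.
rewrite orbF; apply/ler_addgt0Pr => e e0.
have e2 : 0 < e / 2 by rewrite divr_gt0.
have [del del0 H] := dist_mean_continuous (lexx 0) e2.
(* A positive starting time costs at most e/2 by continuity of N at 0 and at most e/2 through the
   missing decay lam s. *)
pose s := Num.min t (Num.min (del / 2) (e / 2 / lam)).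
have s0 : 0 < s by rewrite !lt_min t0 !divr_gt0.
have st : s <= t by rewrite ge_min lexx.
have sdel : `|s - 0| < del.
  rewrite subr0 gtr0_norm// !gt_min; apply/orP; right; apply/orP; left; lra.
have se : lam * s <= e / 2.
  by rewrite mulrC -ler_pdivlMr// !ge_min lexx !orbT.
have := H s (ltW s0) sdel; rewrite ltr_norml => /andP[_ h].
by have := decay_pos s0 st Nt0; lra.
Qed.

End gradient_flow_decay.

Theorem theorem3p5 (d : measure_display) (T : measurableType d) (R : realType)
    (p : R) (m1 m2 : R.-pker T ~> T) (nu1 nu2 : {measure set T -> \bar R})
    (mu : T -> R) (lam : R) (u0 : T -> R) (u : R -> T -> R) :
  1 < p ->
  random_walk_space m1 nu1 -> reversible m1 nu1 ->
  random_walk_space m2 nu2 -> reversible m2 nu2 ->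
  (* nu2 << nu1 with density mu = d nu2 / d nu1 *)
  measurable_fun setT mu ->
  (forall A, measurable A -> nu2 A = (\int[nu1]_(x in A) (mu x)%:E)%E) ->
  (* mu in L^oo(X,nu1) and mu >= c > 0 nu1-a.e. *)
  (exists M : R, {ae nu1, forall x, `|mu x| <= M}) ->
  (exists2 c : R, 0 < c & {ae nu1, forall x, c <= mu x}) ->
  (nu1 setT < +oo)%E ->
  (* 2-Poincare inequality for F_{1,m1} with constant lam *)
  poincare 2 m1 nu1 lam ->
  L2 nu1 u0 ->
  strong_solution p m1 m2 nu1 nu2 mu u0 u ->
  (forall t, 0 < t ->
     (L2norm nu1 (fun x => (u t x - mean nu1 u0)%R) <=
      maxe (L2norm nu1 (fun x => (u0 x - mean nu1 u0)%R) - (lam * t)%R%:E) 0)%E) /\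
  (extinction_time nu1 u (mean nu1 u0) <=
     L2norm nu1 (fun x => (u0 x - mean nu1 u0)%R) * (lam^-1)%:E)%E.
Proof.
move=> p1 _ _ _ rev2 mmu nu2E [M muM] [c0 c00 cmu] fin1 poinc Lu0.
case=> Lu ucont u00 [g [uder ae_opA]].
have lam0 : 0 < lam by case: poinc.
have fin2 := density_finite mmu nu2E muM fin1.
have mu0 : {ae nu1, forall x, 0 <= mu x}.
  by apply: filterS cmu => x; apply: le_trans; exact: ltW.
have dissip : {ae lebesgue_measure, forall t : R, 0 < t ->
    [/\ L2 nu1 (g t), ip nu1 (g t) (fun=> 1) = 0 &
      lam * nrm nu1 (fun x => u t x - mean nu1 (u t)) <= - ip nu1 (g t) (u t)]}.
  apply: ae_lebesgueS ae_opA => t H t0; have opt := H t0.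
  have Lg : L2 nu1 (g t).
    case: opt => _ /L2N Lg _; have -> // : g t = fun x => - - g t x.
    by apply/funext => x; rewrite opprK.
  have Lut := Lu _ (ltW t0).
  have [g1 gu] := opA_dissipative p1 rev2 mmu nu2E mu0 fin1 fin2 poinc opt.
  rewrite ipNl// in gu; rewrite ipNl// in g1; last exact: L2_cst.
  by split => //; apply/eqP; rewrite -oppr_eq0 g1.
have cont t : 0 <= t -> forall e : R, 0 < e ->
    exists2 delta : R, 0 < delta & forall s, 0 <= s -> `|s - t| < delta ->
      nrm nu1 (fun x => u s x - u t x) < e.
  move=> t0 e e0; have [del del0 H] := ucont t t0 e e0; exists del => // s s0 st.
  by rewrite -lte_fin -L2norm_nrm ?H//; apply: L2B; exact: Lu.
have meanE : mean nu1 u0 = mean nu1 (u 0).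
  rewrite /mean; congr (_ * fine _); apply: ae_eq_integral => //.
  - by apply/measurable_EFinP; exact: L2_measurable Lu0.
  - by apply/measurable_EFinP; exact: L2_measurable (Lu _ (lexx 0)).
  - by apply: filterS u00 => x -> _.
have Lm t : 0 <= t -> L2 nu1 (fun x => u t x - mean nu1 u0).
  by move=> t0; apply: L2B; [exact: Lu|exact: L2_cst].
have Lm0 : L2 nu1 (fun x => u0 x - mean nu1 u0).
  by apply: L2B => //; exact: L2_cst.
set N0 := nrm nu1 (fun x => u0 x - mean nu1 u0).
have decay t : 0 < t ->
    nrm nu1 (fun x => u t x - mean nu1 u0) <= Num.max (N0 - lam * t) 0.
  move=> t0; have := dist_mean_decay fin1 lam0 Lu cont uder dissip t0.
  rewrite -meanE (_ : nrm nu1 (fun x => u 0 x - mean nu1 u0) = N0)//.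
  apply: nrm_ae_eq => //; first exact: Lm.
  by apply: filterS u00 => x ->.
split.
  move=> t t0; rewrite (L2norm_nrm (Lm t (ltW t0))) (L2norm_nrm Lm0).
  by rewrite -EFinB -EFin_max lee_fin decay.
(* Admissible extinction times are strictly positive, so the candidate is N0 / lam + e, which is
   positive even when N0 = 0. *)
rewrite (L2norm_nrm Lm0) -EFinM -/N0; apply/lee_addgt0Pr => e e0.
apply: ge_ereal_inf; exists (N0 / lam + e)%:E; last by rewrite EFinD.
exists (N0 / lam + e) => //.
have N00 : 0 <= N0 / lam by rewrite divr_ge0 ?nrm_ge0// ltW.
split; first by rewrite ltr_wpDl.
move=> t tge; have t0 : 0 < t by apply: lt_le_trans tge; rewrite ltr_wpDl.
have Lmt := Lm t (ltW t0).
have : nrm nu1 (fun x => u t x - mean nu1 u0) = 0.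
  apply/eqP; rewrite eq_le nrm_ge0 andbT (le_trans (decay t t0))// ge_max lexx andbT.
  rewrite subr_le0 mulrC -ler_pdivrMr// (le_trans _ tge)// lerDl ltW//.
move=> nrm0; have := L2norm_nrm Lmt; rewrite nrm0.
have mE : measurable_fun setT (fun x => (u t x - mean nu1 u0)%:E).
  by apply/measurable_EFinP; exact: L2_measurable Lmt.
move=> /(Lnorm_eq0_eq0 mE) => /(_ ltac:(by rewrite lte_fin)).
apply: filterS => x /(_ Logic.I) /= [].
by move/eqP; rewrite subr_eq0 => /eqP.
Qed.
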